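(* Let $n\ge 1$ be an integer and let $d=2^{\lfloor n/2\rfloor}$. Let $C_n=\{(x_1,\dots,x_n)\in\mathbb R^n : x_1\ge 0,\ x_1^2\ge x_2^2+\dots+x_n^2\}$. Then there exists an isometric real linear embedding $\phi$ of $\mathbb R^n$ (with its standard inner product) into the space of $d\times d$ self-adjoint complex matrices (with inner product $\langle A,B\rangle=\frac1d\mathrm{Tr}(AB)$) such that $\phi(\mathbf v)$ is positive semidefinite for every $\mathbf v\in C_n$.
   Context: The real vector space of self-adjoint $d\times d$ complex matrices is a Euclidean space with the normalized trace inner product $\langle A,B\rangle=\frac1d\mathrm{Tr}(AB)$; ''isometric'' means norm-preserving (equivalently, inner product preserving) for this inner product. The set $C_n$ is the spherical cone formed by the vectors whose angle with $(1,0,\dots,0)$ does not exceed $\pi/4$ (together with $0$). *)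

(* Defs.v *)
From HB Require Import structures.
From mathcomp Require Import all_boot all_order all_algebra.
From mathcomp Require Import complex.
From mathcomp Require Import reals.

Set Implicit Arguments.
Unset Strict Implicit.
Unset Printing Implicit Defensive.

Import Order.TTheory GRing.Theory Num.Theory.
Local Open Scope ring_scope.
Local Open Scope complex_scope.
Local Open Scope sesquilinear_scope.

Definition std_inner (R : realType) (n : nat) (u v : 'rV[R]_n) : R :=
  \sum_(i < n) u 0 i * v 0 i.

Definition spherical_cone (R : realType) (n : nat) (n_gt0 : (0 < n)%N)
    (x : 'rV[R]_n) : bool :=
  let i1 := Ordinal n_gt0 in
  (0 <= x 0 i1) && (\sum_(i < n | i != i1) x 0 i ^+ 2 <= x 0 i1 ^+ 2).

(* Complex-valued on arbitrary matrices; it takes real values on self-adjoint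
   ones. *)
Definition trace_inner (R : realType) (d : nat) (A B : 'M[R[i]]_d) : R[i] :=
  d%:R^-1 * \tr (A *m B).

(* The order on R[i] is partial: 0 <= z means that z is real and nonnegative. *)
Definition psdmx (R : realType) (d : nat) (A : 'M[R[i]]_d) : Prop :=
  A \is hermsymmx /\ forall u : 'cV[R[i]]_d, 0 <= (u ^t* *m A *m u) 0 0.

(* 'M[R[i]]_d is canonically only an R[i]-module, so real-linearity is
   expressed by letting R act through the embedding R -> R[i]. *)
Notation "{ 'real_linear' U -> V }" :=
  {linear U%type -> V%type | real_complex _ \; *:%R}
  (U at level 98, V at level 99) : type_scope.

(* Main.v *)
Require Import Defs.
From HB Require Import structures.
From mathcomp Require Import all_boot all_order all_algebra.
From mathcomp Require Import complex.
From mathcomp Require Import reals.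

(** Write [n = m + 1].  There are [m] traceless, self-adjoint, pairwise
    anticommuting matrices [g_i] of size [d] with [g_i ^ 2 = 1] (Pauli/Clifford
    matrices), and [phi x = x_1 + H] with [H = \sum_i x_(i+1) g_i].  The
    relations give [Tr (g_i g_j) = d * delta_ij], hence the isometry, and
    [H ^ 2 = r ^ 2] with [r ^ 2 = \sum_i x_(i+1) ^ 2].  Therefore
    [2 x_1 phi x = phi x ^ 2 + (x_1 ^ 2 - r ^ 2)] is positive semidefinite on
    the cone, and so is [phi x] when [x_1 > 0]; if [x_1 = 0] then [x = 0]. *)

Set Implicit Arguments.
Unset Strict Implicit.
Unset Printing Implicit Defensive.

Import Order.TTheory GRing.Theory Num.Theory.
Local Open Scope ring_scope.
Local Open Scope complex_scope.
Local Open Scope sesquilinear_scope.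

Section CliffordMatrices.

Variable C : numClosedFieldType.

(** Indexing by [nat], with only the indices below [m] constrained, lets a new family be defined by
    shifting indices. The trace condition makes each generator orthogonal to the identity. *)
Definition clifford_gens d m (g : nat -> 'M[C]_d) : Prop :=
  [/\ forall i, (i < m)%N -> (g i)^t* = g i,
      forall i, (i < m)%N -> \tr (g i) = 0
    & forall i j, (i < m)%N -> (j < m)%N ->
        g i *m g j + g j *m g i = ((i == j)%:R *+ 2)%:M].

(** With the Pauli matrices [X], [Y], [Z], these are the Kronecker products of [X] and [Y] with the
    identity, followed by those of [Z] with the old generators. *)
Definition clifford_step d (g : nat -> 'M[C]_d) (i : nat) : 'M[C]_(d + d) :=
  match i with
  | 0 => block_mx 0 1%:M 1%:M 0
  | 1 => block_mx 0 (- 'i)%:M 'i%:M 0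
  | i.+2 => block_mx (g i) 0 0 (- g i)
  end.

Lemma clifford_stepP d m (g : nat -> 'M[C]_d) :
  clifford_gens m g -> clifford_gens m.+2 (clifford_step g).
Proof.
case=> gH gT gA.
have mapS (a : C) : (a%:M : 'M_d) ^ Num.conj = (a^*)%:M.
  by rewrite map_scalar_mx.
split=> [[|[|i]] lti|[|[|i]] lti|[|[|i]] [|[|j]] lti ltj] /=.
- by rewrite tr_block_mx map_block_mx !trmx0 !tr_scalar_mx !map_mx0 !mapS
             conjC1.
- by rewrite tr_block_mx map_block_mx !trmx0 !tr_scalar_mx !map_mx0 !mapS
             rmorphN /= conjCi opprK.
- by rewrite tr_block_mx map_block_mx !trmx0 !map_mx0 linearN /= map_mxN gH.
- by rewrite mxtrace_block !mxtrace0 addr0.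
- by rewrite mxtrace_block !mxtrace0 addr0.
- by rewrite mxtrace_block raddfN /= subrr.
(* The nine anticommutator cases are computed blockwise together: mixed types cancel, the two new
   generators square to 1 (using ['i ^+ 2 = -1]), and two old ones reduce to [gA]. *)
all: rewrite !mulmx_block ?mul0mx ?mulmx0 ?mul1mx ?mulmx1 ?addr0 ?add0r.
all: rewrite add_block_mx ?addr0 ?add0r -?scalar_mxM -?raddfD /=.
all: rewrite ?mulNmx ?mulmxN ?scalar_mxC ?opprK ?mulNr ?mulrN.
all: rewrite -?expr2 ?sqrCi ?opprK ?subrr ?addNr ?raddf0 ?mulr1n ?mul0rn.
all: rewrite ?block_mx0 ?gA ?eqSS -?scalar_mx_block ?raddf0 //.
Qed.

Lemma clifford_gens_exist k :
  exists g : nat -> 'M[C]_(2 ^ k), clifford_gens k.*2 g.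
Proof.
(* In size 1 no generator is required, so the zero family serves; each doubling of the size then
   adds two generators. *)
elim: k => [|k [g /clifford_stepP gP]]; first by exists (fun=> 0); split.
by rewrite expnS mul2n -addnn doubleS; exists (clifford_step g).
Qed.

(** Adding the double sum for [H *m H] to its copy with the indices exchanged turns products into
    anticommutators. Only the diagonal terms survive, and the factor 2 is cancelled. *)
Lemma anticommuting_sum_sqr d (I : finType) (P : pred I) (G : I -> 'M[C]_d)
    (c : I -> C) :
  (forall i j, P i -> P j ->
     G i *m G j + G j *m G i = ((i == j)%:R *+ 2)%:M) ->
  (\sum_(i | P i) c i *: G i) *m (\sum_(i | P i) c i *: G i) =
  (\sum_(i | P i) c i ^+ 2)%:M.
Proof.
move=> GA; set H := \sum_(i | _) _.
have E : H *m H = \sum_(i | P i) \sum_(j | P j) (c i * c j) *: (G i *m G j).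
  rewrite mulmx_suml; apply: eq_bigr => i _; rewrite mulmx_sumr.
  by apply: eq_bigr => j _; rewrite -scalemxAl -scalemxAr scalerA.
have E' : H *m H = \sum_(i | P i) \sum_(j | P j) (c i * c j) *: (G j *m G i).
  rewrite E exchange_big; apply: eq_bigr => i _; apply: eq_bigr => j _.
  by rewrite mulrC.
suff : (H *m H) *+ 2 = (\sum_(i | P i) c i ^+ 2)%:M *+ 2.
  rewrite -!scaler_nat; apply: scalerI; by rewrite pnatr_eq0.
rewrite mulr2n {1}E E' -big_split -raddfMn /= -sumrMnl raddf_sum /=.
apply: eq_bigr => i Pi; rewrite -big_split /= (bigD1 i) //= big1 => [|j].
  by rewrite -scalerDr GA // eqxx addr0 scale_scalar_mx mulrnAr mulr1.
by move=> /andP[Pj nji]; rewrite -scalerDr GA // eq_sym (negPf nji) mul0rn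
  raddf0 scaler0.
Qed.

Lemma mulmx_adj_ge0 d (w : 'cV[C]_d) : 0 <= (w^t* *m w) 0 0.
Proof.
rewrite mxE sumr_ge0 // => i _.
by rewrite !mxE mulrC mul_conjC_ge0.
Qed.

Lemma hermsymmx_adjE d (A : 'M[C]_d) : (A \is hermsymmx) = (A^t* == A).
Proof. by rewrite is_hermitianmxE expr0 scale1r eq_sym. Qed.

(** Since [A] is self-adjoint, [a] times the form at [u] equals the squared norm of [A *m u] plus
    [b] times that of [u]; then divide by [a]. *)
Lemma psd_form_of_sqr d (A : 'M[C]_d) (a b : C) (u : 'cV[C]_d) :
  A^t* = A -> 0 < a -> 0 <= b -> a *: A = A *m A + b%:M ->
  0 <= (u^t* *m A *m u) 0 0.
Proof.
move=> AH a0 b0 /(congr1 (fun B => (u^t* *m B *m u) 0 0)).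
rewrite -scalemxAr -scalemxAl [LHS]mxE mulmxDr mulmxDl [RHS]mxE => E.
rewrite -(pmulr_rge0 _ a0) E addr_ge0 //.
  have <- : (A *m u)^t* *m (A *m u) = u^t* *m (A *m A) *m u.
    by rewrite trmx_mul map_mxM AH !mulmxA.
  exact: mulmx_adj_ge0.
by rewrite mul_mx_scalar -scalemxAl mxE mulr_ge0 // mulmx_adj_ge0.
Qed.

End CliffordMatrices.

Section Embedding.

Variables (R : realType) (n d : nat) (G : 'I_n -> 'M[R[i]]_d).

Definition real_comb (v : 'rV[R]_n) : 'M[R[i]]_d :=
  \sum_(i < n) (v 0 i)%:C *: G i.

Lemma real_comb_is_linear : linear_for (real_complex R \; *:%R) real_comb.
Proof.
move=> a u v; rewrite /real_comb /= scaler_sumr -big_split /=.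
apply: eq_bigr => i _.
by rewrite !mxE rmorphD rmorphM scalerDl scalerA.
Qed.

HB.instance Definition _ :=
  GRing.isLinear.Build R 'rV[R]_n 'M[R[i]]_d (real_complex R \; *:%R)
    real_comb real_comb_is_linear.

Lemma real_comb_adj v : (forall i, (G i)^t* = G i) ->
  (real_comb v)^t* = real_comb v.
Proof.
move=> GH; rewrite /real_comb raddf_sum raddf_sum /=; apply: eq_bigr => i _.
rewrite linearZ /= map_mxZ GH; congr (_ *: _).
exact: conjc_real.
Qed.

Lemma real_comb_inner u v : (0 < d)%N ->
  (forall i j, \tr (G i *m G j) = (i == j)%:R * d%:R) ->
  trace_inner (real_comb u) (real_comb v) = (std_inner u v)%:C.
Proof.
move=> d0 GT; rewrite /trace_inner /std_inner mulmx_suml !raddf_sum mulr_sumr.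
apply: eq_bigr => i _; rewrite mulmx_sumr raddf_sum (bigD1 i) //= big1 => [|j].
  rewrite -scalemxAl -scalemxAr !mxtraceZ GT eqxx mul1r addr0 rmorphM.
  have cancel (a b c : R[i]) : c != 0 -> c^-1 * (a * (b * c)) = a * b.
    by move=> c0; rewrite mulrC -!mulrA divff // mulr1.
  by apply: cancel; rewrite pnatr_eq0 -lt0n.
move=> /negPf nji; rewrite -scalemxAl -scalemxAr !mxtraceZ GT eq_sym nji.
by rewrite mul0r !mulr0.
Qed.

End Embedding.

Theorem theorem2p1 (R : realType) (n : nat) (n_gt0 : (0 < n)%N) :
  let d := (2 ^ n./2)%N in
  exists phi : {real_linear 'rV[R]_n -> 'M[R[i]]_d},
    [/\ injective phi,
        forall v, phi v \is hermsymmx,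
        forall u v, trace_inner (phi u) (phi v) = (std_inner u v)%:C
      & forall v, spherical_cone n_gt0 v -> psdmx (phi v)].
Proof.
move=> d; have d0 : (0 < d)%N by rewrite expn_gt0.
have [g [gH gT gA]] := clifford_gens_exist R[i] n./2.
(* The first coordinate goes to the identity, and coordinate [k.+1] to the generator [g k]. *)
pose G (i : 'I_n) : 'M[R[i]]_d := if val i is k.+1 then g k else 1%:M.
pose i1 := Ordinal n_gt0.
have G1 : G i1 = 1%:M by [].
have GE i : i != i1 -> exists k, [/\ i = k.+1 :> nat, (k < n./2.*2)%N & G i = g k].
  case: i => -[|k] ltk; first by rewrite -val_eqE.
  (* There are [n - 1] generators to supply: all [n./2.*2] available ones if [n] is odd, one fewer
     if [n] is even. *)
  move=> _; exists k; split=> //; move: ltk; rewrite -{1}(odd_double_half n).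
  by case: (odd n) => //= /ltnW.
have GH i : (G i)^t* = G i.
  have [->|/GE[k [_ ltk ->]]] := eqVneq i i1; last exact: gH.
  by rewrite G1 trmx1 map_mx1.
have GA i j : i != i1 -> j != i1 ->
    G i *m G j + G j *m G i = ((i == j)%:R *+ 2)%:M.
  move=> /GE[k [ik ltk ->]] /GE[l [jl ltl ->]].
  by rewrite gA // -val_eqE /= ik jl eqSS.
have GT i j : \tr (G i *m G j) = (i == j)%:R * d%:R.
  have [->|ni] := eqVneq i i1; have [->|nj] := eqVneq j i1.
  - by rewrite G1 mulmx1 mxtrace1 mul1r.
  - have [k [_ ltk ->]] := GE _ nj.
    by rewrite G1 mul1mx gT // mul0r.
  - have [k [_ ltk ->]] := GE _ ni.
    by rewrite (negPf ni) G1 mulmx1 gT // mul0r.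
  (* By cyclicity of the trace, the anticommutator has trace twice that of [G i *m G j]. *)
  have /(congr1 mxtrace) := GA _ _ ni nj.
  rewrite mxtraceD (mxtrace_mulC (G j)) mxtrace_scalar -mulr2n mulrnAC.
  by rewrite -[LHS]mulr_natr -[RHS]mulr_natr => /mulIf ->;
    rewrite ?pnatr_eq0 // mulr_natr.
have inner u v := real_comb_inner u v d0 GT.
have adj v := real_comb_adj v GH.
exists (real_comb G); split=> //.
(* A vector in the kernel has zero norm by the isometry; taking real parts gives a vanishing sum of
   real squares. *)
- apply: raddf_inj => v v0; apply/rowP => i; rewrite mxE.
  have := inner v v; rewrite v0 /trace_inner mul0mx mxtrace0 mulr0.
  move=> /(congr1 (@complex.Re R)) /esym /eqP /=.
  rewrite psumr_eq0 => [/allP/(_ i)|j _]; last by rewrite -expr2 sqr_ge0.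
  by rewrite mem_index_enum -expr2 sqrf_eq0 => /(_ isT)/eqP.
- by move=> v; rewrite hermsymmx_adjE adj.
move=> v /andP[t0 rt]; split=> [|u]; first by rewrite hermsymmx_adjE adj.
rewrite -/i1 in t0 rt.
pose H := \sum_(i < n | i != i1) (v 0 i)%:C *: G i.
have phiE : real_comb G v = (v 0 i1)%:C%:M + H.
  by rewrite /real_comb (bigD1 i1) //= G1 scalemx1.
have HH : H *m H = ((\sum_(i < n | i != i1) v 0 i ^+ 2)%:C)%:M.
  rewrite anticommuting_sum_sqr //; congr _%:M.
  by rewrite rmorph_sum; apply: eq_bigr => i _; rewrite rmorphXn.
(* The apex is treated apart, because the square argument divides by [2 t]. *)
move: t0; rewrite le_eqVlt => /predU1P[t0|t0].
  suff phi0 : real_comb G v = 0 by rewrite /= phi0 mulmx0 mul0mx mxE.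
  rewrite phiE -t0 raddf0 add0r; apply: big1 => i ni.
  have r0 : \sum_(i < n | i != i1) v 0 i ^+ 2 == 0.
    rewrite eq_le (le_trans rt) ?sumr_ge0 -?t0 ?expr0n //.
    by move=> j _; apply: sqr_ge0.
  move: r0; rewrite psumr_eq0 => [/allP/(_ i)|j _]; last exact: sqr_ge0.
  by rewrite mem_index_enum ni /= sqrf_eq0 => /(_ isT)/eqP ->; rewrite scale0r.
pose t := v 0 i1; pose r2 := \sum_(i < n | i != i1) v 0 i ^+ 2.
(* As [H *m H] is the scalar [r2], the square of [t + H] is [t ^+ 2 + 2 t H + r2], which forces this
   choice of [a] and [b]; the cone inequality is exactly [0 <= b]. *)
apply: (@psd_form_of_sqr _ _ _ (t *+ 2)%:C (t ^+ 2 - r2)%:C).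
- exact: adj.
- by rewrite ltcR pmulrn_lgt0.
- by rewrite lecR subr_ge0.
rewrite /= phiE -/t mulmxDl !mulmxDr HH -/r2 -scalar_mxM.
rewrite mul_scalar_mx mul_mx_scalar scalerDr scale_scalar_mx.
rewrite [_ *: H + _%:M]addrC addrACA [RHS]addrAC -scalerDl.
congr (_ + _ *: _); last by rewrite -rmorphD.
rewrite -!raddfD /= -!rmorphM -!rmorphD /=; congr _%:C%:M.
by rewrite -addrA [r2 + _]addrC subrK -expr2 mulrnAl -expr2 mulr2n.
Qed.
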